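(* Let $X$ be a nonempty set and let $\mathcal{P}_1$ be a nonempty family of pseudometrics on $X$ such that for each pair $x,y$ of distinct points of $X$ there exists $\rho\in\mathcal{P}_1$ with $\rho(x,y)>0$. For each $\rho\in\mathcal{P}_1$ and $i\in\mathbb{N}$ let $U_{i,\rho}=\{(x,y)\in X\times X:\rho(x,y)<\frac{1}{2^i}\}$. Then the family $\mathcal{B}=\{U_{i,\rho}:\rho\in\mathcal{P}_1,\ i\in\mathbb{N}\}$ is a pre-base for a strongly pre-uniformity $\mu$ on the set $X$, and each pseudometric $\rho\in\mathcal{P}_1$ is strongly pre-uniform with respect to $\mu$. If, moreover, $X$ is a pre-topological space, all pseudometrics of the family $\mathcal{P}_1$ are pre-continuous functions from $X\times X$ to the real line, and for each $x\in X$ and each nonempty closed set $A\subseteq X$ with $x\notin A$ there exists $\rho\in\mathcal{P}_1$ such that $\inf\{\rho(x,a):a\in A\}>0$, then $\mu$ is a strongly pre-uniformity on the space $X$.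
   Context: $\mathbb{N}$ is the set of positive integers. A pre-topology on a set $Z$ is a family $\mathscr{T}\subseteq 2^{Z}$ with $\bigcup\mathscr{T}=Z$ that is closed under arbitrary unions (including the empty union); its members are called open and their complements closed. If $X$ is a pre-topological space, $X\times X$ carries the product pre-topology, whose open sets are the unions of sets $O_1\times O_2$ with $O_1,O_2$ open in $X$. A map between pre-topological spaces is pre-continuous if preimages of open sets are open; the real line carries its usual topology. For a nonempty set $X$ put $\triangle=\{(x,x):x\in X\}$; for $A,B\subseteq X\times X$ and $x\in X$ put $A^{-1}=\{(y,x):(x,y)\in A\}$, $A\circ B=\{(x,y): \exists z\in X,\ (x,z)\in A \text{ and } (z,y)\in B\}$, $A[x]=\{y\in X:(x,y)\in A\}$. A pre-uniform structure (pre-uniformity) on $X$ is a nonempty family $\mu$ of nonempty subsets of $X\times X$ such that: (U1) $\triangle\subseteq U$ for all $U\in\mu$; (U2) $U\in\mu$ implies $U^{-1}\in\mu$; (U3) for each $U\in\mu$ there are $V,W\in\mu$ with $V\circ W\subseteq U$; (U4) if $U\in\mu$ and $U\subseteq V\subseteq X\times X$ then $V\in\mu$; (U5) $\bigcap\mu=\triangle$. It is a strongly pre-uniformity if moreover (U3$'$) for each $U\in\mu$ there is $V\in\mu$ with $V\circ V\subseteq U$. A family $\mathcal{B}\subseteq\mu$ is a pre-base for $\mu$ if each $V\in\mu$ contains some $W\in\mathcal{B}$; so $\mu$ consists of all subsets of $X\times X$ containing a member of $\mathcal{B}$. A pseudometric $\rho$ on $X$ is (strongly) pre-uniform with respect to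 a (strongly) pre-uniformity $\mu$ if for each $\varepsilon>0$ there is $V\in\mu$ such that $\rho(x,y)<\varepsilon$ whenever $(x,y)\in V$. The induced pre-topology of $\mu$ is $\tau(\mu)=\{G\subseteq X:\text{for each }x\in G\text{ there is }U\in\mu\text{ with }U[x]\subseteq G\}$. A (strongly) pre-uniformity $\mu$ on the set $X$ is said to be a (strongly) pre-uniformity on the pre-topological space $X$ if $\tau(\mu)$ equals the given pre-topology of $X$. *)

(* Defs.v *)
From mathcomp Require Import all_boot all_order all_algebra.
From mathcomp Require Import all_classical all_reals all_analysis.

Set Implicit Arguments.
Unset Strict Implicit.
Unset Printing Implicit Defensive.

Import Order.TTheory GRing.Theory Num.Theory.
Import numFieldNormedType.Exports.

Local Open Scope classical_set_scope.
Local Open Scope ring_scope.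

(* The empty union is covered by the case [F = set0] of [pretop_bigcup]. *)
Record is_pretopology (Z : Type) (T : set (set Z)) : Prop := {
  pretop_cover : \bigcup_(O in T) O = setT;
  pretop_bigcup : forall F : set (set Z), F `<=` T -> T (\bigcup_(O in F) O)
}.

Definition pretop_closed (Z : Type) (T : set (set Z)) (A : set Z) : Prop :=
  T (~` A).

Definition prod_pretopology (X : Type) (T : set (set X)) : set (set (X * X)) :=
  [set O | exists2 F : set (set (X * X)),
     F `<=` [set O1 `*` O2 | O1 in T & O2 in T] & O = \bigcup_(P in F) P].

Definition precontinuous (Z W : Type) (TZ : set (set Z)) (TW : set (set W))
    (f : Z -> W) : Prop :=
  forall O, TW O -> TZ (f @^-1` O).

(* The library's [B \; A] is [set xy | exists2 z, A (xy.1, z) & B (z, xy.2)],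
   so that A \circ B = {(x, y) | exists z, (x, z) in A and (z, y) in B} reads
   [(B \; A)%relation]. *)
Record is_preuniformity (X : Type) (mu : set (set (X * X))) : Prop := {
  preunif_nonempty : mu !=set0;
  preunif_mem_nonempty : forall U, mu U -> U !=set0;
  preunif_refl : forall U, mu U -> diagonal `<=` U;
  preunif_inv : forall U, mu U -> mu (U^-1)%relation;
  preunif_comp : forall U, mu U ->
    exists V W, [/\ mu V, mu W & (W \; V)%relation `<=` U];
  preunif_up : forall U V, mu U -> U `<=` V -> mu V;
  preunif_sep : \bigcap_(U in mu) U = diagonal
}.

Record is_strongly_preuniformity (X : Type) (mu : set (set (X * X))) : Prop := {
  strongly_preunif_preunif : is_preuniformity mu;
  strongly_preunif_comp : forall U, mu U ->
    exists2 V, mu V & (V \; V)%relation `<=` U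
}.

Definition is_prebase (X : Type) (B mu : set (set (X * X))) : Prop :=
  B `<=` mu /\ forall V, mu V -> exists2 W, B W & W `<=` V.

Record is_pseudometric (R : realType) (X : Type) (rho : X * X -> R) : Prop := {
  pseudometric_ge0 : forall x y, 0 <= rho (x, y);
  pseudometric_refl : forall x, rho (x, x) = 0;
  pseudometric_sym : forall x y, rho (x, y) = rho (y, x);
  pseudometric_triangle : forall x y z,
    rho (x, z) <= rho (x, y) + rho (y, z)
}.

Record strongly_preuniform (R : realType) (X : Type)
    (mu : set (set (X * X))) (rho : X * X -> R) : Prop := {
  strongly_preuniform_mu : is_strongly_preuniformity mu;
  strongly_preuniform_pseudometric : is_pseudometric rho;
  strongly_preuniform_lt : forall e : R, 0 < e ->
    exists2 V, mu V & forall x y, V (x, y) -> rho (x, y) < e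
}.

(* [xsection U x] is the set usually written U[x]. *)
Definition induced_pretopology (X : Type) (mu : set (set (X * X))) :
    set (set X) :=
  [set G | forall x, G x -> exists2 U, mu U & xsection U x `<=` G].

Definition strongly_preuniformity_on (X : Type) (T : set (set X))
    (mu : set (set (X * X))) : Prop :=
  is_strongly_preuniformity mu /\ induced_pretopology mu = T.

Definition pseudometric_entourage (R : realType) (X : Type)
    (i : nat) (rho : X * X -> R) : set (X * X) :=
  [set xy | rho xy < 1 / 2 ^+ i].

(* The exponent ranges over the positive integers. *)
Definition pseudometric_prebase (R : realType) (X : Type)
    (P1 : set (X * X -> R)) : set (set (X * X)) :=
  [set pseudometric_entourage i rho | i in [set i | (0 < i)%N] & rho in P1].

(* Main.v *)
Require Import Defs.
From mathcomp Require Import all_boot all_order all_algebra.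
From mathcomp Require Import all_classical all_reals all_analysis.
Import Order.TTheory GRing.Theory Num.Theory.
Import numFieldNormedType.Exports.

Local Open Scope classical_set_scope.
Local Open Scope ring_scope.

(** The pre-uniformity is the family of all supersets of the sets
    rho < 1 / 2 ^ i.  No finite intersections have to be formed, so the closure
    axioms can be checked for one pseudometric at a time: symmetry makes the
    entourages symmetric, and the triangle inequality puts the square of the
    entourage of index i + 1 inside the one of index i
    ([pseudometric_entourage_comp]).  The intersection of all entourages is the
    diagonal because the pseudometrics separate points and 1 / 2 ^ i tends to 0
    ([pseudometric_preuniformity_sep]).

    The induced pre-topology is compared with T as follows.  A ball
    [{y | rho (x, y) < 1 / 2 ^ i}] is a section of an open set of the product,
    hence open ([prod_pretopology_xsection]), so a set containing such a ball
    around each of its points is a union of members of T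
    ([induced_pretopology_sub]).  Conversely, for x in an open set G, some rho
    is bounded away from 0 between x and the complement of G, so a small
    rho-ball around x stays in G ([sub_induced_pretopology]). *)

(** Closure under unions alone makes openness a local property. *)
Lemma pretop_locally {X : Type} (T : set (set X)) (G : set X) :
  is_pretopology T ->
  (forall x, G x -> exists O, [/\ T O, O x & O `<=` G]) -> T G.
Proof.
move=> hT hG.
have -> : G = \bigcup_(O in [set O | T O /\ O `<=` G]) O.
  apply/seteqP; split=> [x /hG [V [TV Vx VG]]|x [V [_ VG] /VG]] //.
  by exists V.
by apply: (pretop_bigcup hT) => V [].
Qed.

(** The section at x of a union of open boxes is the union of the second sides
    of those boxes whose first side contains x. *)
Lemma prod_pretopology_xsection {X : Type} (T : set (set X)) W (x : X) :
  is_pretopology T -> prod_pretopology T W -> T (xsection W x).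
Proof.
move=> hT [F FT ->]; apply: pretop_locally => // y.
rewrite /xsection /= inE => -[P FP Pxy].
have [V1 TV1 [V2 TV2 PE]] := FT _ FP.
move: Pxy; rewrite -PE => -[/= V1x V2y].
exists V2; split=> // z V2z.
by rewrite /= inE; exists P => //; rewrite -PE.
Qed.

Lemma exists_half_expn_lt {R : realType} (e : R) :
  0 < e -> exists2 i, (0 < i)%N & 1 / 2 ^+ i < e.
Proof.
move=> e0; near \oo => i; exists i; first by near: i; exact: nbhs_infty_gt.
by near: i; exact: (near_infty_natSinv_expn_lt (PosNum e0)).
Unshelve. all: by end_near. Qed.

Section Pseudometric.
Context {R : realType} {X : Type} {rho : X * X -> R}.
Hypothesis hrho : is_pseudometric rho.

Lemma pseudometric_entourage_refl i :
  diagonal `<=` pseudometric_entourage i rho.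
Proof.
move=> [x y]; rewrite /diagonal /= => ->.
rewrite /pseudometric_entourage /= (pseudometric_refl hrho).
by rewrite divr_gt0 ?exprn_gt0.
Qed.

Lemma pseudometric_entourage_inv i :
  (pseudometric_entourage i rho)^-1%relation = pseudometric_entourage i rho.
Proof.
apply/seteqP; split=> -[x y];
by rewrite /pseudometric_entourage /= (pseudometric_sym hrho).
Qed.

(** Halving the radius leaves room for one use of the triangle inequality. *)
Lemma pseudometric_entourage_comp i :
  (pseudometric_entourage i.+1 rho \; pseudometric_entourage i.+1 rho)%relation
    `<=` pseudometric_entourage i rho.
Proof.
move=> [x y] [z /= xz zy]; rewrite /pseudometric_entourage /=.
apply: (le_lt_trans (pseudometric_triangle hrho x z y)).
have -> : 1 / 2 ^+ i = 1 / 2 ^+ i.+1 + 1 / 2 ^+ i.+1 :> R.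
  by rewrite [LHS]splitr !mul1r exprSr invfM.
exact: ltrD.
Qed.

End Pseudometric.

(** Supersets of single entourages, not of finite intersections of them: a
    pre-uniformity need not be a filter. *)
Definition pseudometric_preuniformity {R : realType} {X : Type}
    (P1 : set (X * X -> R)) : set (set (X * X)) :=
  [set V | exists2 W, pseudometric_prebase P1 W & W `<=` V].

Section Preuniformity.
Context {R : realType} {X : Type} {P1 : set (X * X -> R)}.
Local Notation mu := (pseudometric_preuniformity P1).

Lemma pseudometric_preuniformity_entourage i rho :
  (0 < i)%N -> P1 rho -> mu (pseudometric_entourage i rho).
Proof.
move=> i0 Prho; exists (pseudometric_entourage i rho) => //.
by exists i => //; exists rho.
Qed.

Lemma pseudometric_preuniformityP V :
  mu V -> exists i rho,
    [/\ (0 < i)%N, P1 rho & pseudometric_entourage i rho `<=` V].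
Proof. by move=> [_ [i i0 [rho Prho <-]] sV]; exists i, rho. Qed.

Lemma pseudometric_preuniformity_prebase :
  is_prebase (pseudometric_prebase P1) mu.
Proof. by split=> // W BW; exists W. Qed.

Hypothesis hP1 : P1 !=set0.

(** Around a point x of an open set G other than X, the ball to take is that of
    a pseudometric separating x from the complement of G, with a radius below
    the infimum of its values there.  The separation hypothesis is silent when
    the complement is empty; then any entourage will do. *)
Lemma sub_induced_pretopology (T : set (set X)) :
  (forall rho, P1 rho -> is_pseudometric rho) ->
  (forall (x : X) (A : set X), A !=set0 -> pretop_closed T A -> ~ A x ->
     exists2 rho, P1 rho & 0 < inf [set rho (x, a) | a in A]) ->
  T `<=` induced_pretopology mu.
Proof.
move=> hpseudo hreg G TG x Gx.
have [A0|/set0P A0] := eqVneq (~` G) set0.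
  have [rho Prho] := hP1.
  exists (pseudometric_entourage 1 rho).
    exact: pseudometric_preuniformity_entourage.
  by rewrite -(setCK G) A0 setC0.
have [||rho Prho inf_gt0] := hreg x (~` G) A0.
- by rewrite /pretop_closed setCK.
- by apply.
have [i i0 i_lt] := exists_half_expn_lt _ inf_gt0.
exists (pseudometric_entourage i rho).
  exact: pseudometric_preuniformity_entourage.
move=> y; rewrite /xsection /= inE /pseudometric_entourage /= => xy.
apply: contrapT => nGy.
have : inf [set rho (x, a) | a in ~` G] <= rho (x, y).
  apply: ge_inf; last by exists y.
  by exists 0 => _ [a _ <-]; exact: pseudometric_ge0 (hpseudo _ Prho) _ _.
by rewrite leNgt (lt_trans xy i_lt).
Qed.

Hypothesis hpseudo : forall rho, P1 rho -> is_pseudometric rho.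

(** Only sections matter here: a ball is open as the section at its centre of
    the preimage of an open ray, although the pseudometric is pre-continuous
    on the product only. *)
Lemma induced_pretopology_sub (T : set (set X)) :
  is_pretopology T ->
  (forall rho, P1 rho ->
     precontinuous (prod_pretopology T) [set O : set R | open O] rho) ->
  induced_pretopology mu `<=` T.
Proof.
move=> hT hcont G hG; apply: pretop_locally => // x /hG[U].
move=> /pseudometric_preuniformityP[i [rho [i0 Prho sU]]] UG.
exists (xsection (pseudometric_entourage i rho) x); split.
- apply: prod_pretopology_xsection => //.
  exact: hcont _ Prho _ (@open_lt R (1 / 2 ^+ i)).
- rewrite /xsection /= inE.
  exact: (pseudometric_entourage_refl (hpseudo _ Prho)).
- by apply: subset_trans UG; exact: le_xsection.
Qed.

Lemma pseudometric_preuniformity_comp U :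
  mu U -> exists2 V, mu V & (V \; V)%relation `<=` U.
Proof.
move=> /pseudometric_preuniformityP[i [rho [i0 Prho sU]]].
exists (pseudometric_entourage i.+1 rho).
  exact: pseudometric_preuniformity_entourage.
exact: subset_trans (pseudometric_entourage_comp (hpseudo _ Prho) i) sU.
Qed.

Lemma pseudometric_preuniformity_refl U : mu U -> diagonal `<=` U.
Proof.
move=> /pseudometric_preuniformityP[i [rho [i0 Prho sU]]].
exact: subset_trans (pseudometric_entourage_refl (hpseudo _ Prho) i) sU.
Qed.

Lemma pseudometric_preuniformity_sep :
  (forall x y : X, x <> y -> exists2 rho, P1 rho & 0 < rho (x, y)) ->
  \bigcap_(U in mu) U = diagonal.
Proof.
move=> hsep; apply/seteqP; split; last first.
  by move=> xy dxy U muU; exact: pseudometric_preuniformity_refl dxy.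
move=> [x y] capxy; apply: contrapT => /hsep[rho Prho rho_gt0].
have [i i0 i_lt] := exists_half_expn_lt _ rho_gt0.
have := capxy _ (pseudometric_preuniformity_entourage _ _ i0 Prho).
by rewrite /pseudometric_entourage /= => /(lt_trans i_lt); rewrite ltxx.
Qed.

Lemma pseudometric_preuniformity_strong :
  [set: X] !=set0 ->
  (forall x y : X, x <> y -> exists2 rho, P1 rho & 0 < rho (x, y)) ->
  is_strongly_preuniformity mu.
Proof.
move=> [x _] hsep; split; last exact: pseudometric_preuniformity_comp.
split.
- have [rho Prho] := hP1; exists (pseudometric_entourage 1 rho).
  exact: pseudometric_preuniformity_entourage.
- by move=> U /pseudometric_preuniformity_refl dU; exists (x, x); exact: dU.
- exact: pseudometric_preuniformity_refl.
- move=> U /pseudometric_preuniformityP[i [rho [i0 Prho sU]]].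
  exists (pseudometric_entourage i rho).
    by exists i => //; exists rho.
  rewrite -(pseudometric_entourage_inv (hpseudo _ Prho)).
  by move=> [a b]; exact: sU.
- by move=> U /pseudometric_preuniformity_comp[V muV VU]; exists V, V.
- by move=> U V [W BW WU] UV; exists W => //; exact: subset_trans UV.
- exact: pseudometric_preuniformity_sep.
Qed.

End Preuniformity.

Theorem proposition4p4 (R : realType) (X : Type) (P1 : set (X * X -> R))
  (hX : [set: X] !=set0)
  (hP1 : P1 !=set0)
  (hpseudo : forall rho, P1 rho -> is_pseudometric rho)
  (hsep : forall x y : X, x <> y -> exists2 rho, P1 rho & 0 < rho (x, y)) :
  exists mu : set (set (X * X)),
    [/\ is_strongly_preuniformity mu,
        is_prebase (pseudometric_prebase P1) mu,
        forall rho, P1 rho -> strongly_preuniform mu rho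
      & forall T : set (set X),
          is_pretopology T ->
          (forall rho, P1 rho ->
             precontinuous (prod_pretopology T) [set O : set R | open O] rho) ->
          (forall (x : X) (A : set X), A !=set0 -> pretop_closed T A -> ~ A x ->
             exists2 rho, P1 rho & 0 < inf [set rho (x, a) | a in A]) ->
          strongly_preuniformity_on T mu].
Proof.
have hmu := pseudometric_preuniformity_strong hP1 hpseudo hX hsep.
exists (pseudometric_preuniformity P1); split=> //.
- exact: pseudometric_preuniformity_prebase.
- move=> rho Prho; split=> //; first exact: hpseudo.
  move=> e /exists_half_expn_lt[i i0 i_lt].
  exists (pseudometric_entourage i rho).
    exact: pseudometric_preuniformity_entourage.
  by move=> x y xy; exact: lt_trans xy i_lt.
- move=> T hT hcont hreg; split=> //; apply/seteqP; split.
    exact: induced_pretopology_sub.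
  exact: sub_induced_pretopology.
Qed.
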